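(* Let $Q_\infty=(q_0,q_1,q_2,\dots)$ be any infinite stochastic vector with positive coordinates, fix a GLS-expansion with cylinder lengths given by $Q_\infty$, and let $V=\{i_1,i_2,\dots,i_k,i_{k+1},\dots\}\subset\mathbb{N}_0$. Then \[\dim_H\bigl(C[\mathit{GLS},V]\bigr)=\sup\Bigl\{x:\ \sum_{i\in V} q_i^x\ge 1\Bigr\}.\]
   Context: GLS-expansion: Let $Q_\infty=(q_0,q_1,\dots)$ be a stochastic vector with positive coordinates ($q_i>0$, $\sum_{i\ge 0} q_i=1$). Choose closed intervals $\Delta_i=[a_i,b_i]\subset[0,1]$, $i\in\mathbb{N}_0$, with pairwise disjoint interiors and $|\Delta_i|=q_i$ (cylinders of rank 1). Let $f_i:[0,1]\to\Delta_i$ be the increasing affine bijection. The cylinders of rank $n$ are $\Delta_{i_1i_2\dots i_n}=f_{i_1}\circ\dots\circ f_{i_n}([0,1])$, so the placement of $\Delta_{i_1\dots i_n}$ inside $\Delta_{i_1\dots i_{n-1}}$ is the same as that of $\Delta_{i_n}$ inside $[0,1]$ and $|\Delta_{i_1\dots i_n}|=q_{i_1}\cdots q_{i_n}$. For any sequence $(i_k)$ in $\mathbb{N}_0$, $\bigcap_k \Delta_{i_1\dots i_k}$ is a single point, denoted $\Delta^{\mathit{GLS}}_{i_1i_2\dots}$. For $V\subset\mathbb{N}_0$, $C[\mathit{GLS},V]=\{\Delta^{\mathit{GLS}}_{\alpha_1\alpha_2\dots}:\ \alpha_k\in V \text{ for all } k\}$. In the supremum, $x$ ranges over real numbers and the series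 $\sum_{i\in V}q_i^x$ is allowed to take the value $+\infty$. *)

(* Defs.v *)
From HB Require Import structures.
From mathcomp Require Import all_boot all_order all_algebra.
From mathcomp Require Import all_classical all_reals all_analysis.
Set Implicit Arguments. Unset Strict Implicit. Unset Printing Implicit Defensive.
Import Order.TTheory GRing.Theory Num.Theory.
Local Open Scope classical_set_scope.
Local Open Scope ring_scope.

Section Hausdorff.
Variable R : realType.

(* diameter of a subset of R (-oo for the empty set, +oo if unbounded) *)
Definition diam (A : set R) : \bar R :=
  ereal_sup [set z | exists x y, A x /\ A y /\ z = (`|x - y|)%:E].

Definition cover_term (s : R) (U : set R) : \bar R :=
  if U == set0 then 0%E else (powR (fine (diam U)) s)%:E.

Definition hausdorff_delta (s delta : R) (E : set R) : \bar R :=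
  ereal_inf [set (\sum_(0 <= n <oo) cover_term s (U n))%E
            | U in [set U : nat -> set R |
                    E `<=` \bigcup_n U n /\ forall n, (diam (U n) <= delta%:E)%E]].

(* s-dimensional Hausdorff outer measure: limit (= sup) as delta -> 0+ *)
Definition hausdorff_measure (s : R) (E : set R) : \bar R :=
  ereal_sup [set hausdorff_delta s delta E | delta in [set d : R | 0 < d]].

Definition hausdorff_dim (E : set R) : \bar R :=
  ereal_inf [set s%:E | s in [set s : R | 0 <= s /\ hausdorff_measure s E = 0%E]].

(* GLS-expansion: cylinder of rank 1 number i is [a i, a i + q i];
   f_i x = a i + q i * x.  gls_comp a q alpha n = f_{alpha 0} o ... o f_{alpha (n-1)} *)
Fixpoint gls_comp (a q : nat -> R) (alpha : nat -> nat) (n : nat) : R -> R :=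
  match n with
  | 0 => id
  | n'.+1 => fun x => gls_comp a q alpha n' (a (alpha n') + q (alpha n') * x)
  end.

Definition gls_cylinder (a q : nat -> R) (alpha : nat -> nat) (n : nat) : set R :=
  gls_comp a q alpha n @` `[0, 1]%classic.

Definition GLS_data (a q : nat -> R) : Prop :=
  (forall i, 0 < q i) /\
  (\sum_(0 <= i <oo) ((q i)%:E) = 1%E)%E /\
  (forall i, 0 <= a i /\ a i + q i <= 1) /\
  (forall i j, i <> j ->
     `]a i, a i + q i[%classic `&` `]a j, a j + q j[%classic = set0).

(* C[GLS, V]: points Delta^GLS_{alpha_1 alpha_2 ...} (= the unique point of the
   nested intersection of cylinders) with all digits in V *)
Definition C_GLS (a q : nat -> R) (V : set nat) : set R :=
  [set x | exists alpha : nat -> nat,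
      (forall k, V (alpha k)) /\ forall n, gls_cylinder a q alpha n x].

End Hausdorff.

(* Main.v *)
(** Upper bound: if sigma = sum_(i in V) q_i^s < 1, then replacing a cover of
    E = C[GLS, V] by its images under all the maps f_i, i in V, multiplies its s-sum by sigma and its mesh
    by sup q_i < 1; iterating from [0, 1] gives H^s(E) = 0.

    Lower bound: if s < t and sum_(i in V) q_i^t >= 1, then sum_(i in F) q_i^s >= 1 for
    some finite subset F of V; let r = min_F q.  To a cover (W_j) of E by sets of
    diameters at most d_j, associate the measure
    mu = sum_j r^-1 d_j^(s-1) Leb|[x_j - 2 d_j, x_j + 2 d_j], with x_j in W_j.
    If sum_j d_j^s were small, then mu(]0, 1[) < 1, and as the children of a cylinder are
    disjoint and sum_F q_i^s >= 1, one could descend along digits of F through cylinders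
    with mu(cylinder) < |cylinder|^s.  The limit point lies in some W_j, and the first
    cylinder around it of length at most d_j has length at least r d_j and satisfies
    mu(cylinder) >= |cylinder|^s: a contradiction.  Compactness of E is never needed. *)
Require Import Defs.
From HB Require Import structures.
From mathcomp Require Import all_boot all_order all_algebra.
From mathcomp Require Import all_classical all_reals all_analysis.
From mathcomp Require Import ring lra.
Import Order.TTheory GRing.Theory Num.Theory.
Local Open Scope classical_set_scope.
Local Open Scope ring_scope.

Section GLS.
Variable R : realType.
Implicit Types (a q : nat -> R) (V : set nat) (U : set R) (s t : R).

(** * Cylinder lengths and self-similarity *)

Lemma GLS_length_ub a q : GLS_data a q ->
  exists2 rho : R, 0 < rho < 1 & forall i, q i <= rho.
Proof.
move=> [q0 [q1 _]].
have pair i : q 0%N + q i.+1 <= 1.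
  rewrite -lee_fin -q1.
  apply: le_trans (nneseries_lim_ge i.+2 _); last by move=> *; rewrite lee_fin ltW.
  rewrite big_mkord big_ord_recl big_ord_recr /= EFinD leeD2l //.
  by rewrite leeDr // sume_ge0 // => *; rewrite lee_fin ltW.
(* By [pair], every later length is at most 1 - q_0, and q_0 itself is at most 1 - q_1. *)
exists (Num.max (1 - q 0%N) (1 - q 1%N)).
  rewrite lt_max gt_max; have := pair 0%N; have := q0 0%N; have := q0 1%N.
  by move=> h1 h2 h3; apply/andP; split; [apply/orP; left; lra|apply/andP; split; lra].
move=> [|i]; rewrite le_max; [have := pair 0%N|have := pair i]; move=> h;
  apply/orP; [right|left]; lra.
Qed.

(** The recursion of [gls_comp] peels off the innermost map; self-similarity needs the outermost
    one, which belongs to the first digit. *)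
Lemma gls_comp_shift a q (alpha : nat -> nat) n x :
  gls_comp a q alpha n.+1 x =
  a (alpha 0%N) + q (alpha 0%N) * gls_comp a q (fun k => alpha k.+1) n x.
Proof. by elim: n x => [//|n IH] x; exact: IH. Qed.

Lemma C_GLS_sub_image a q V x : GLS_data a q -> C_GLS a q V x ->
  exists2 i, V i & exists2 y, C_GLS a q V y & x = a i + q i * y.
Proof.
move=> [q0 _] [alpha [Va cx]]; exists (alpha 0%N) => //.
set i := alpha 0%N; have qi : q i != 0 by rewrite gt_eqF.
exists ((x - a i) / q i); last by rewrite mulrC divfK //; ring.
exists (fun k => alpha k.+1); split=> // n.
have [y y01 <-] := cx n.+1; exists y => //.
by rewrite gls_comp_shift -/i addrC addKr mulrC mulKf.
Qed.

Lemma C_GLS_sub01 a q V : C_GLS a q V `<=` `[0, 1].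
Proof. by move=> x [alpha [_ /(_ 0%N)]] [y y01 <-]. Qed.

(** * Diameters and s-sums under affine maps *)

Lemma diam_ge_dist U x y : U x -> U y -> (`|x - y|%:E <= diam U)%E.
Proof. by move=> Ux Uy; apply: ereal_sup_ubound; exists x, y. Qed.

Lemma diam_le U d :
  (forall x y, U x -> U y -> `|x - y| <= d) -> (diam U <= d%:E)%E.
Proof.
by move=> h; apply: ge_ereal_sup => z [x [y [Ux [Uy ->]]]]; rewrite lee_fin h.
Qed.

Lemma diam_fin U x d : U x -> (diam U <= d%:E)%E ->
  exists2 r, diam U = r%:E & 0 <= r <= d.
Proof.
move=> Ux; have := diam_ge_dist _ _ _ Ux Ux; rewrite subrr normr0.
by case: (diam U) => // r r0 rd; exists r; rewrite // -!lee_fin r0.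
Qed.

Lemma cover_term_ge0 s U : (0 <= cover_term s U)%E.
Proof. by rewrite /cover_term; case: ifP => // _; rewrite lee_fin powR_ge0. Qed.

Lemma cover_term_nonempty s U x d : U x -> diam U = d%:E ->
  cover_term s U = (d `^ s)%:E.
Proof.
by move=> Ux Ud; rewrite /cover_term ifF ?Ud //; apply/eqP => U0; rewrite U0 in Ux.
Qed.

Lemma diam_affine_image (b r d : R) U : 0 < r -> (diam U <= d%:E)%E ->
  (diam ((fun x => b + r * x)%R @` U) <= (r * d)%:E)%E.
Proof.
move=> r0 Ud; apply: diam_le => _ _ [x Ux <-] [y Uy <-].
rewrite (_ : _ - _ = r * (x - y)); last by ring.
rewrite normrM gtr0_norm // ler_pM2l // -lee_fin.
exact: le_trans (diam_ge_dist _ _ _ Ux Uy) Ud.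
Qed.

Lemma cover_term_affine_image (b r s d : R) U :
  0 < r -> 0 <= s -> (diam U <= d%:E)%E ->
  (cover_term s ((fun x => b + r * x)%R @` U) <= (r `^ s)%:E * cover_term s U)%E.
Proof.
move=> r0 s0 Ud; have [->|/set0P [x Ux]] := eqVneq U set0.
  by rewrite image_set0 /cover_term eqxx mule0.
have [e Ue /andP[e0 _]] := diam_fin _ _ _ Ux Ud.
have fUx : ((fun x => b + r * x) @` U) (b + r * x) by exists x.
have [|e' fUe /andP[e'0 e'e]] := diam_fin _ _ (r * e) fUx.
  by apply: diam_affine_image; rewrite ?Ue.
rewrite (cover_term_nonempty _ _ _ _ fUx fUe) (cover_term_nonempty _ _ _ _ Ux Ue).
rewrite -EFinM lee_fin -powRM ?(ltW r0) //.
by rewrite ge0_ler_powR // nnegrE // mulr_ge0 // ltW.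
Qed.

Lemma hausdorff_delta_ge0 s d U : (0 <= hausdorff_delta s d U)%E.
Proof.
apply: le_ereal_inf_tmp => _ [W _ <-].
by apply: nneseries_ge0 => *; exact: cover_term_ge0.
Qed.

(** * Upper bound: iterated covers *)

Lemma C_GLS_cover a q V (rho s sigma : R) n : GLS_data a q ->
  0 < rho -> (forall i, q i <= rho) -> 0 <= s -> 0 <= sigma ->
  (\esum_(i in V) (q i `^ s)%:E <= sigma%:E)%E ->
  exists W : nat -> set R,
    [/\ C_GLS a q V `<=` \bigcup_n W n,
        forall k, (diam (W k) <= (rho ^+ n)%:E)%E &
        (\sum_(0 <= k <oo) cover_term s (W k) <= (sigma ^+ n)%:E)%E].
Proof.
move=> gls rho0 qrho s0 sigma0 Vsigma; have q0 := gls.1.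
elim: n => [|n [W [EW dW sW]]].
  exists (fun k => if k == 0%N then `[0, 1]%classic else set0); split.
  - by move=> x Ex; exists 0%N => //=; exact: C_GLS_sub01 Ex.
  - move=> k; apply: diam_le => x y; rewrite expr0; case: eqP => // _ /=.
    by rewrite !in_itv /= => /andP[? ?] /andP[? ?]; rewrite ler_norml; lra.
  - have U0 : (`[0, 1]%classic : set R) 0 by rewrite /= in_itv /= lexx ler01.
    have [|r Ur /andP[r0 r1]] := diam_fin _ _ 1 U0.
      apply: diam_le => x y /=; rewrite !in_itv /= => /andP[? ?] /andP[? ?].
      by rewrite ler_norml; lra.
    rewrite (nneseries_split 0%N 1%N) ?addn0; last by move=> *; exact: cover_term_ge0.
    rewrite big_nat1 eqxx eseries0 ?adde0.
      rewrite (cover_term_nonempty _ _ _ _ U0 Ur) lee_fin expr0.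
      have -> : 1 = 1 `^ s :> R by rewrite powR1.
      by rewrite ge0_ler_powR // nnegrE.
    by move=> [|k] //= _ _; rewrite /cover_term eqxx.
(* The images f_i(W_k) are indexed by pairs and must be renumbered as one sequence. Pairs with i
   outside V receive the empty set, which costs 0. *)
have /card_set_bijP [e eb] : ([set: nat] #= [set: nat * nat])%card.
  by rewrite card_eq_sym card_nat2.
pose W' (p : nat * nat) : set R :=
  if p.1 \in V then (fun x => a p.1 + q p.1 * x) @` W p.2 else set0.
exists (W' \o e); split.
- move=> x Ex; have [i Vi [y Ey ->]] := C_GLS_sub_image _ _ _ _ gls Ex.
  have [k _ Wky] := EW _ Ey.
  have [_ _ /(_ (i, k) I) [m _ em]] := eb.
  by exists m => //=; rewrite em /W' /= mem_set //; exists y.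
- move=> k; rewrite /= /W'; case: ifP => _.
    apply: le_trans (diam_affine_image _ _ _ _ (q0 _) (dW _)) _.
    by rewrite lee_fin exprS ler_wpM2r // exprn_ge0 // ltW.
  by apply: diam_le.
- rewrite nneseries_esumT; last by move=> *; exact: cover_term_ge0.
  rewrite /= -(reindex_esum setT setT e (cover_term s \o W')) //.
  pose g (i k : nat) := cover_term s (W' (i, k)).
  have -> : \esum_(p in [set: nat * nat]) (cover_term s \o W') p
     = \esum_(i in [set: nat]) \esum_(k in [set: nat]) g i k.
    rewrite esum_esum; last by move=> *; exact: cover_term_ge0.
    rewrite (_ : setT `*`` _ = setT); last by apply/seteqP; split => // -[].
    by apply: eq_esum => -[].
  (* For a fixed digit i in V, the whole old cover is scaled by q_i, so its s-sum picks up the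
     factor q_i^s. *)
  have gsum (i : nat) : (\esum_(k in [set: nat]) g i k <=
      (sigma ^+ n)%:E * (if i \in V then (q i `^ s)%:E else 0))%E.
    rewrite /g /W' /=; case: ifP => iV; last first.
      by rewrite esum1 ?mule0 // => k _; rewrite /cover_term eqxx.
    apply: (@le_trans _ _ (\esum_(k in [set: nat]) ((q i `^ s)%:E * cover_term s (W k)))%E).
      by apply: le_esum => k _; exact: cover_term_affine_image.
    rewrite -nneseries_esumT; last first.
      by move=> k; rewrite mule_ge0 ?lee_fin ?powR_ge0 ?cover_term_ge0.
    rewrite nneseriesZl; last by move=> *; exact: cover_term_ge0.
    by rewrite muleC lee_wpmul2r // lee_fin powR_ge0.
  apply: le_trans (le_esum (fun i _ => gsum i)) _.
  have ge0 i : (0 <= (if i \in V then (q i `^ s)%:E else 0))%E.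
    by case: ifP => // _; rewrite lee_fin powR_ge0.
  have sn0 : (0 <= (sigma ^+ n)%:E)%E by rewrite lee_fin exprn_ge0.
  rewrite -nneseries_esumT; last by move=> i; rewrite mule_ge0.
  rewrite nneseriesZl // nneseries_esumT // -esum_mkcond exprS mulrC EFinM.
  by rewrite lee_wpmul2l.
Qed.

Lemma hausdorff_measure_C_GLS_eq0 a q V s : GLS_data a q -> 0 <= s ->
  (\esum_(i in V) (q i `^ s)%:E < 1)%E ->
  hausdorff_measure s (C_GLS a q V) = 0%E.
Proof.
move=> gls s0 V1.
have [rho /andP[rho0 rho1] qrho] := GLS_length_ub _ _ gls.
have V0 : (0 <= \esum_(i in V) (q i `^ s)%:E)%E.
  by apply: esum_ge0 => *; rewrite lee_fin powR_ge0.
have [sigma sigmaE] : exists sigma, \esum_(i in V) (q i `^ s)%:E = sigma%:E.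
  by move: V0 V1; case: (\esum_(i in V) _) => // r; exists r.
rewrite sigmaE in V0 V1; rewrite lee_fin in V0; rewrite lte_fin in V1.
apply/eqP; rewrite eq_le; apply/andP; split; last first.
  apply: le_trans (hausdorff_delta_ge0 s 1 (C_GLS a q V)) _.
  by apply: ereal_sup_ubound; exists 1; rewrite /= ?ltr01.
apply: ge_ereal_sup => _ [d /= d0 <-]; apply/lee_addgt0Pr => e e0; rewrite add0e.
have geo (r : R) : 0 <= r -> r < 1 -> r ^+ n @[n --> \oo] --> 0.
  by move=> r0 r1; apply: cvg_expr; rewrite ger0_norm.
have small (r f : R) : 0 <= r -> r < 1 -> 0 < f -> \forall n \near \oo, r ^+ n < f.
  by move=> r0 r1 f0; apply: (cvgr_lt (0 : R)) => //; exact: geo.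
(* A single rank n must make both the mesh and the s-sum of the cover small. *)
have [n [rn sn]] : exists n, rho ^+ n < d /\ sigma ^+ n < e.
  apply: (@filter_ex _ \oo).
  by apply: filterI; apply: small => //; exact: ltW.
have [|W [EW dW sW]] := C_GLS_cover a q V rho s sigma n gls rho0 qrho s0 V0.
  by rewrite sigmaE.
apply: (@le_trans _ _ (sigma ^+ n)%:E); last by rewrite lee_fin ltW.
apply: le_trans sW; apply: ereal_inf_lbound; exists W => //; split=> // k.
by apply: le_trans (dW k) _; rewrite lee_fin ltW.
Qed.

(** * Descent through light cylinders *)

Lemma child_interval_trivIset a q (F : set nat) (c l : R) : GLS_data a q -> 0 < l ->
  trivIset F (fun i => `]c + l * a i, c + l * (a i + q i)[%classic).
Proof.
move=> [_ [_ [_ disj]]] l0; apply/trivIsetP => i j _ _ /eqP ij.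
have scale (k : nat) x : `]c + l * a k, c + l * (a k + q k)[%classic x ->
    `]a k, a k + q k[%classic ((x - c) / l).
  by rewrite /= !in_itv /= ltr_pdivlMr // ltr_pdivrMr // ![_ * l]mulrC ltrBrDl ltrBlDl.
rewrite -subset0 => x [/scale xi /scale xj].
have := disj i j ij; rewrite -subset0 => disj0.
by apply: (disj0 ((x - c) / l)); split.
Qed.

Section descent.
Variables (a q : nat -> R) (t : R) (F : set nat).
Variable mu : {measure set (measurableTypeR R) -> \bar R}.
Hypothesis gls : GLS_data a q.
Hypothesis finF : finite_set F.
Hypothesis F1 : (1 <= \sum_(i \in F) (q i `^ t)%:E)%E.

(** If every child with digit in F were heavy, additivity over the disjoint open children and [F1]
    would give the parent mass at least l^t. *)
Lemma exists_light_child (c l : R) : 0 < l ->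
  (mu `]c, (c + l)%R[%classic < (l `^ t)%:E)%E ->
  exists i, F i /\
    (mu `](c + l * a i)%R, (c + l * a i + l * q i)%R[%classic
       < ((l * q i) `^ t)%:E)%E.
Proof.
move=> l0 mul; apply: contrapT => nex.
have q0 := gls.1; have a01 := gls.2.2.1.
have heavy i : F i -> (((l * q i) `^ t)%:E <=
    mu `](c + l * a i)%R, (c + l * (a i + q i))%R[%classic)%E.
  move=> Fi; rewrite leNgt; apply/negP => h; apply: nex; exists i; split => //.
  by rewrite -addrA -mulrDr.
move: mul; apply/negP; rewrite -leNgt.
apply: (@le_trans _ _ ((l `^ t)%:E * \sum_(i \in F) (q i `^ t)%:E)%E).
  by rewrite -[leLHS]mule1 lee_wpmul2l // lee_fin powR_ge0.
rewrite ge0_mule_fsumr; last by move=> i; rewrite lee_fin powR_ge0.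
apply: (@le_trans _ _ (\sum_(i \in F)
    mu `](c + l * a i)%R, (c + l * (a i + q i))%R[%classic)%E).
  apply: lee_fsum => // i Fi; rewrite -EFinM -powRM ?(ltW l0) ?(ltW (q0 i)) //.
  exact: heavy.
rewrite -measure_fin_bigcup //; last exact: child_interval_trivIset.
apply: le_measure; rewrite ?inE //.
  by apply: fin_bigcup_measurable.
move=> x [i Fi] /=; rewrite !in_itv /= => /andP[h1 h2].
have [ai0 ai1] := a01 i; apply/andP; split.
  by apply: le_lt_trans h1; rewrite lerDl mulr_ge0 // ltW.
by apply: lt_le_trans h2 _; rewrite lerD2l -[leRHS]mulr1 ler_pM2l.
Qed.

Lemma exists_light_branch : (mu `]0%R, 1%R[%classic < 1)%E ->
  exists alpha : nat -> nat, (forall k, F (alpha k)) /\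
    forall n, let c := gls_comp a q alpha n 0 in
      let l := \prod_(k < n) q (alpha k) in
      (mu `]c, (c + l)%R[%classic < (l `^ t)%:E)%E.
Proof.
move=> mu01; have q0 := gls.1.
(* A cylinder is encoded by its left endpoint and its length. *)
pose light (p : R * R) := 0 < p.2 /\ (mu `]p.1, (p.1 + p.2)%R[%classic < (p.2 `^ t)%:E)%E.
pose child (p : R * R) i := (p.1 + p.2 * a i, p.2 * q i).
have /choice [digit digitP] (p : R * R) :
    exists i, light p -> F i /\ light (child p i).
  (* The digit 0 is a dummy for intervals that are not light; the orbit [st] never meets one. *)
  have [lp|] := pselect (light p); last by exists 0%N.
  have [i [Fi li]] := exists_light_child p.1 p.2 lp.1 lp.2.
  by exists i => _; split => //; split => //=; rewrite mulr_gt0 ?q0 // lp.1.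
pose st n := iter n (fun p => child p (digit p)) (0, 1).
have stl n : light (st n).
  elim: n => [|n IH]; last by have [] := digitP _ IH.
  by split; rewrite /= ?ltr01 // add0r powR1.
pose alpha n := digit (st n); exists alpha; split.
  by move=> k; have [] := digitP _ (stl k).
move=> n /=.
have affine m x : gls_comp a q alpha m x = (st m).1 + (st m).2 * x.
  elim: m x => [|m IH] x /=; first by rewrite add0r mul1r.
  by rewrite IH /alpha; ring.
have len m : \prod_(k < m) q (alpha k) = (st m).2.
  by elim: m => [|m IH]; rewrite ?big_ord0 // big_ord_recr /= IH.
by rewrite affine len mulr0 addr0; have [] := stl n.
Qed.

End descent.

(** * Lower bound: limit points and weighted covers *)

Lemma gls_compE a q alpha n x : gls_comp a q alpha n x =
  gls_comp a q alpha n 0 + (\prod_(k < n) q (alpha k)) * x.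
Proof.
elim: n x => [|n IH] x /=; first by rewrite big_ord0 mul1r add0r.
by rewrite IH [in RHS]IH big_ord_recr /=; ring.
Qed.

(** Cylinders are nested, so left endpoints increase, right endpoints decrease, and each left
    endpoint is below each right one. The supremum of the left endpoints therefore lies in every
    cylinder. *)
Lemma exists_gls_point a q alpha : GLS_data a q ->
  exists x, forall n, gls_cylinder a q alpha n x.
Proof.
move=> [q0 [_ [a01 _]]].
pose c n := gls_comp a q alpha n 0; pose l n := \prod_(k < n) q (alpha k).
have l0 n : 0 < l n by apply: prodr_gt0 => i _; exact: q0.
have cS n : c n.+1 = c n + l n * a (alpha n).
  by rewrite /c /= gls_compE mulr0 addr0.
have lS n : l n.+1 = l n * q (alpha n) by rewrite /l big_ord_recr.
have nest n : c n <= c n.+1 /\ c n.+1 + l n.+1 <= c n + l n.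
  have [h1 h2] := a01 (alpha n); rewrite cS lS; split.
    by rewrite lerDl mulr_ge0 // ltW.
  by rewrite -addrA -mulrDr lerD2l -[leRHS]mulr1 ler_pM2l.
have cmono : {homo c : m n / (m <= n)%N >-> m <= n}.
  by apply/nondecreasing_seqP => n; have [] := nest n.
have dmono : {homo (fun n => c n + l n) : m n / (m <= n)%N >-> n <= m}.
  by apply/nonincreasing_seqP => n; have [] := nest n.
have cd m n : c m <= c n + l n.
  apply: (@le_trans _ _ (c (maxn m n))); first by rewrite cmono ?leq_maxl.
  apply: le_trans (dmono _ _ (leq_maxr m n)).
  by rewrite lerDl ltW.
have sc : has_sup (range c).
  by split; [exists (c 0%N), 0%N|exists (c 0%N + l 0%N) => _ [m _ <-]].
exists (sup (range c)) => n; exists ((sup (range c) - c n) / l n).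
  rewrite /= in_itv /= divr_ge0 ?subr_ge0 ?(ltW (l0 n)) //=; last first.
    by apply: sup_ubound; [exact: sc.2|exists n].
  rewrite ler_pdivrMr // mul1r lerBlDl.
  by apply: ge_sup; [exact: sc.1|move=> _ [m _ <-]].
rewrite gls_compE -/(c n) -/(l n) mulrC divfK ?gt_eqF //; ring.
Qed.

(* Makes degenerate covering sets (d = 0) have positive size, at an arbitrarily
   small cost. *)
Lemma powR_bump (t d e : R) : 0 <= t -> 0 <= d <= 1 -> 0 < e ->
  exists d', [/\ d <= d', 0 < d' <= 1 & d' `^ t <= d `^ t + e].
Proof.
move=> t0 /andP[d0 d1] e0; have dt0 := powR_ge0 d t.
have [t00|tn0] := eqVneq t 0.
  by exists 1; rewrite d1 ltr01 lexx t00 !powRr0; split => //; rewrite lerDl ltW.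
have tpos : 0 < t by rewrite lt_neqAle eq_sym tn0.
have powK (x : R) : 0 <= x -> (x `^ t) `^ t^-1 = x.
  by move=> x0; rewrite -powRrM divff // powRr1.
have powVK (x : R) : 0 <= x -> (x `^ t^-1) `^ t = x.
  by move=> x0; rewrite -powRrM mulVf // powRr1.
have x0 : 0 < d `^ t + e by rewrite ltr_wpDl.
exists (Num.min 1 ((d `^ t + e) `^ t^-1)); split.
- rewrite le_min d1 /= -[leLHS]powK // ge0_ler_powR ?invr_ge0 // ?nnegrE //; last 1 first.
    by rewrite lerDl ltW.
  exact: ltW.
- by rewrite lt_min ltr01 powR_gt0 //= ge_min lexx.
- rewrite -[leRHS]powVK ?(ltW x0) // ge0_ler_powR // ?nnegrE ?powR_ge0 //.
    by rewrite le_min ler01 powR_ge0.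
  by rewrite ge_min lexx orbT.
Qed.

Lemma nneseries_ge_term (u : nat -> \bar R) n :
  (forall k, (0 <= u k)%E) -> (u n <= \sum_(0 <= k <oo) u k)%E.
Proof.
move=> u0; apply: le_trans (nneseries_lim_ge n.+1 _) => //.
by rewrite big_mkord big_ord_recr /= leeDr // sume_ge0.
Qed.

(* With d >= diam U from [powR_bump], the weight is w = r^-1 d^(t-1); it is 0 when
   U is empty. *)
Lemma cover_set_weight (t r e : R) U : 0 <= t -> 0 < r <= 1 -> 0 < e ->
  (diam U <= 1%:E)%E ->
  exists p : R * R * {nonneg R}, let: (x, d, w) := p in
  [/\ 0 < d <= 1,
      ((w%:num * (4 * d))%:E <= (4 / r)%:E * (cover_term t U + e%:E))%E &
      forall y, U y -> `|y - x| <= d /\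
        forall l, r * d <= l <= d -> l `^ t <= w%:num * l].
Proof.
move=> t0 /andP[r0 r1] e0 U1; have [->|/set0P [x Ux]] := eqVneq U set0.
  exists (0, 1, 0%:nng); split; rewrite ?ltr01 ?lexx //.
  by rewrite mul0r mule_ge0 // ?lee_fin ?divr_ge0 ?ltW // /cover_term eqxx add0e lte_fin.
have [d0 Ud /andP[d00 d01]] := diam_fin _ _ _ Ux U1.
have [|d [d0d /andP[dpos d1] dt]] := powR_bump t d0 e t0 _ e0; first by rewrite d00.
have w0 : 0 <= r^-1 * (d `^ t / d).
  by rewrite mulr_ge0 ?invr_ge0 ?divr_ge0 ?powR_ge0 // ltW.
exists (x, d, NngNum w0); split; first by rewrite dpos.
  rewrite (cover_term_nonempty _ _ _ _ Ux Ud) -EFinD -EFinM lee_fin /=.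
  have -> : r^-1 * (d `^ t / d) * (4 * d) = 4 / r * d `^ t.
    by field; rewrite !gt_eqF.
  by rewrite ler_pM2l // divr_gt0.
move=> y Uy; split.
  apply: le_trans d0d; rewrite -lee_fin -Ud.
  exact: diam_ge_dist.
move=> l /andP[rl ld] /=; have l0 : 0 <= l by apply: le_trans rl; rewrite mulr_ge0 // ltW.
(* The bound l <= d gives l^t <= d^t, and r d <= l gives d^t <= d^t l / (r d) = w l. *)
apply: (@le_trans _ _ (d `^ t)); first by rewrite ge0_ler_powR // nnegrE // ltW.
rewrite (_ : _ * l = d `^ t * (l / (r * d))); last by field; rewrite !gt_eqF.
by rewrite ler_peMr ?powR_ge0 // ler_pdivlMr ?mulr_gt0 // mul1r.
Qed.

(** The constant r/8 is chosen so that a t-sum below r/8, plus bumps of total at most r/8, times the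
    factor 4/r from [cover_set_weight], stays below 1. The mesh bound 1 keeps every d_j in ]0,
    1]. *)
Lemma hausdorff_delta_C_GLS_ge a q V t (F : set nat) (r : R) :
  GLS_data a q -> 0 <= t -> finite_set F -> F `<=` V ->
  (1 <= \sum_(i \in F) (q i `^ t)%:E)%E ->
  0 < r <= 1 -> (forall i, F i -> r <= q i) ->
  ((r / 8)%:E <= hausdorff_delta t 1 (C_GLS a q V))%E.
Proof.
move=> gls t0 finF FV F1 r01 rq; have q0 := gls.1; have /andP[r0 r1] := r01.
apply: le_ereal_inf_tmp => _ [W [EW dW] <-]; rewrite leNgt; apply/negP => sW.
pose e j : R := r / 8 / (2 ^ j.+1)%:R.
have e0 j : 0 < e j by rewrite divr_gt0 ?divr_gt0 // ltr0n expn_gt0.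
have /choice [p pP] j := cover_set_weight _ _ _ _ t0 r01 (e0 j) (dW j).
pose x j := (p j).1.1; pose d j := (p j).1.2; pose w j := (p j).2.
have pE j : p j = (x j, d j, w j) by rewrite /x /d /w; case: (p j) => -[].
(* The radius is 2 d_j because a point of W_j is within d_j of x_j, and a cylinder around it of
   length at most d_j reaches at most d_j further. Such a cylinder lies in I_j and has mass at least
   w_j times its length. *)
pose I j : set (measurableTypeR R) := `[x j - 2 * d j, x j + 2 * d j]%classic.
have mI j : measurable (I j) by exact: measurable_itv.
pose mu : {measure set (measurableTypeR R) -> \bar R} :=
  mseries (fun j => mscale (w j) (mrestr lebesgue_measure (mI j))) 0%N.
have muE A : mu A = (\sum_(0 <= j <oo) (w j)%:num%:E * lebesgue_measure (A `&` I j))%E.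
  by [].
have term0 A j : (0 <= (w j)%:num%:E * lebesgue_measure (A `&` I j))%E.
  by rewrite mule_ge0 // lee_fin.
have dpos j : 0 < d j <= 1 by have := pP j; rewrite pE => -[].
have wd j : (((w j)%:num * (4 * d j))%:E
    <= (4 / r)%:E * (cover_term t (W j) + (e j)%:E))%E.
  by have := pP j; rewrite pE => -[].
have Wj j y : W j y -> `|y - x j| <= d j /\
    forall l, r * d j <= l <= d j -> l `^ t <= (w j)%:num * l.
  by have := pP j; rewrite pE => -[_ _ h] /h.
have mu1 : (mu `]0%R, 1%R[%classic < 1)%E.
  rewrite muE.
  apply: (@le_lt_trans _ _
      (\sum_(0 <= j <oo) (4 / r)%:E * (cover_term t (W j) + (e j)%:E))%E).
    apply: lee_nneseries => [j _ _|j _]; first exact: term0.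
    apply: le_trans (wd j); rewrite EFinM lee_wpmul2l ?lee_fin //.
    apply: (@le_trans _ _ (lebesgue_measure (I j))).
      by apply: le_measure; rewrite ?inE //; exact: measurableI.
    have /andP[dj _] := dpos j.
    rewrite lebesgue_measure_itv /= lte_fin; case: ifP => _; last first.
      by rewrite lee_fin mulr_ge0 // ltW.
    by rewrite -EFinD lee_fin; lra.
  rewrite nneseriesZl; last first.
    by move=> j _; rewrite adde_ge0 ?cover_term_ge0 // lee_fin ltW.
  apply: (@le_lt_trans _ _ ((4 / r)%:E *
      (\sum_(0 <= j <oo) cover_term t (W j) + (r / 8)%:E))%E).
    rewrite lee_wpmul2l ?lee_fin ?divr_ge0 ?(ltW r0) //.
    apply: epsilon_trick; last by rewrite divr_ge0 // ltW.
    by move=> j; exact: cover_term_ge0.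
  have S0 : (0 <= \sum_(0 <= j <oo) cover_term t (W j))%E.
    by apply: nneseries_ge0 => j _ _; exact: cover_term_ge0.
  move: S0 sW; case: (\sum_(0 <= j <oo) _)%E => [S _|_|//]; last first.
    by rewrite ltNge leey.
  rewrite lte_fin -EFinD -EFinM lte_fin mulrAC ltr_pdivrMr // mul1r.
  lra.
have [alpha [Fa light]] := exists_light_branch _ _ _ _ _ gls finF F1 mu1.
have [z zcyl] := exists_gls_point _ _ alpha gls.
have [|j _ Wjz] := EW z; first by exists alpha; split => // k; exact: FV.
have [zx wl] := Wj _ _ Wjz; have /andP[dj0 dj1] := dpos j.
pose l n := \prod_(k < n) q (alpha k).
have l0 n : 0 < l n by apply: prodr_gt0 => i _; exact: q0.
have [rho /andP[rho0 rho1] qrho] := GLS_length_ub _ _ gls.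
have lrho n : l n <= rho ^+ n.
  elim: n => [|n IH]; rewrite /l ?big_ord0 // big_ord_recr /= exprSr.
  by rewrite ler_pM // ltW // l0.
(* Such an n exists because l n <= rho^n tends to 0. *)
have [|n ln nmin] := @ex_minnP (fun n => l n <= d j).
  apply: (@filter_ex _ \oo); near=> n.
  apply: (le_trans (lrho n)); near: n.
  apply: (cvgr_le (0 : R)) => //; apply: cvg_expr.
  by rewrite ger0_norm // ltW.
(* By minimality the parent is longer than d_j, and one digit of F shrinks it by a factor at least
   r. For n = 0 the length is 1, and r and d_j are at most 1. *)
have rdl : r * d j <= l n.
  case: n ln nmin => [|n] ln nmin.
    by rewrite /l big_ord0 mulr_ile1 // ltW.
  have : d j <= l n by rewrite leNgt; apply/negP => /ltW /nmin; rewrite ltnn.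
  move=> dl; rewrite /l big_ord_recr /= mulrC ler_pM ?(ltW r0) ?(ltW dj0) //.
  by apply: rq; exact: Fa.
have := light n; apply/negP; rewrite -leNgt -/(l n).
set c := gls_comp a q alpha n 0.
apply: (@le_trans _ _ ((w j)%:num * l n)%:E); first by rewrite lee_fin wl // rdl.
rewrite muE; apply: le_trans (nneseries_ge_term _ j (term0 _)).
have czl : c <= z <= c + l n.
  have [y] := zcyl n; rewrite /= in_itv /= gls_compE => /andP[y0 y1] <-.
  rewrite -/c -/(l n) lerDl mulr_ge0 ?(ltW (l0 n)) //=.
  by rewrite lerD2l -[leRHS]mulr1 ler_pM2l.
rewrite setIidl.
  rewrite lebesgue_measure_itv /= lte_fin ltrDl l0 -EFinD addrAC subrr add0r.
  by rewrite EFinM.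
rewrite /I => y /=; rewrite !in_itv /= => /andP[cy yc].
move: zx czl ln; rewrite ler_norml => /andP[zx1 zx2] /andP[cz zc] ln.
by apply/andP; split; lra.
Unshelve. all: by end_near.
Qed.

(** The gap between s and t makes a finite set of digits suffice: q_i^t <= rho^(t-s) q_i^s, so if
    all finite sums of q_i^s were below 1, the full sum of q_i^t would be at most rho^(t-s) < 1. *)
Lemma hausdorff_measure_C_GLS_gt0 a q V s t : GLS_data a q -> 0 <= s < t ->
  (1 <= \esum_(i in V) (q i `^ t)%:E)%E ->
  (0 < hausdorff_measure s (C_GLS a q V))%E.
Proof.
move=> gls /andP[s0 st] V1; have q0 := gls.1.
have [rho /andP[rho0 rho1] qrho] := GLS_length_ub _ _ gls.
have ts0 : 0 < t - s by rewrite subr_gt0.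
have qts i : q i `^ t <= rho `^ (t - s) * q i `^ s.
  have -> : q i `^ t = q i `^ (t - s) * q i `^ s.
    by rewrite -powRD ?subrK // (gt_eqF (q0 i)) implybT.
  by rewrite ler_wpM2r ?powR_ge0 // ge0_ler_powR // ?nnegrE; apply: ltW.
have rts1 : rho `^ (t - s) < 1.
  have -> : 1 = 1 `^ (t - s) :> R by rewrite powR1.
  by rewrite gt0_ltr_powR // ?nnegrE // ltW.
have [F [finF FV F1]] : exists F, [/\ finite_set F, F `<=` V &
    (1 <= \sum_(i \in F) (q i `^ s)%:E)%E].
  apply: contrapT => nF; move: V1; apply/negP; rewrite -ltNge.
  apply: (@le_lt_trans _ _ (rho `^ (t - s))%:E); last by rewrite lte_fin.
  apply: ge_ereal_sup => _ [F [finF FV] <-].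
  apply: (@le_trans _ _ (\sum_(i \in F) ((rho `^ (t - s))%:E * (q i `^ s)%:E))%E).
    by apply: lee_fsum => [//|k _]; rewrite -EFinM lee_fin.
  rewrite -ge0_mule_fsumr; last by move=> i; rewrite lee_fin powR_ge0.
  rewrite -[leRHS]mule1 lee_wpmul2l ?lee_fin ?powR_ge0 //.
  by apply: ltW; rewrite ltNge; apply/negP => F1; apply: nF; exists F.
have [r r01 rq] : exists2 r, 0 < r <= 1 & forall i, F i -> r <= q i.
  (* The minimum of q over F is built along an enumeration, starting from 1 so that r <= 1. *)
  have /finite_seqP [u ->] := finF; elim: u {F finF FV F1} => [|i u [r /andP[r0 r1] rq]].
    by exists 1; rewrite ?ltr01 ?lexx.
  exists (Num.min r (q i)); first by rewrite lt_min r0 q0 ge_min r1.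
  move=> k; rewrite /= inE ge_min => /orP[/eqP ->|ku]; first by rewrite lexx orbT.
  by rewrite rq.
apply: lt_le_trans (_ : _ < (r / 8)%:E)%E _.
  by rewrite lte_fin divr_gt0 //; case/andP: r01.
apply: le_trans (hausdorff_delta_C_GLS_ge _ _ _ _ _ _ gls s0 finF FV F1 r01 rq) _.
by apply: ereal_sup_ubound; exists 1 => //=; rewrite ltr01.
Qed.

End GLS.

Theorem theorem3 (R : realType) (q a : nat -> R) (V : set nat) :
  GLS_data a q -> infinite_set V ->
  hausdorff_dim (C_GLS a q V) =
  ereal_sup [set x%:E | x in
    [set x : R | (1 <= \esum_(i in V) (powR (q i) x)%:E)%E]].
Proof.
move=> gls infV; set S := ereal_sup _.
(* The exponent 0 is admissible, since each digit of V then contributes 1. This makes the exponents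
   D + e below nonnegative. *)
have S0 : (0 <= S)%E.
  apply: ereal_sup_ubound; exists 0 => //=.
  have [i Vi] := infinite_setN0 infV.
  apply: esum_ge; exists [set i]; first by split => // _ ->.
  by rewrite fsbig_set1 powRr0.
apply/eqP; rewrite eq_le; apply/andP; split.
  have [->|Sfin] := eqVneq S +oo%E; first exact: leey.
  have {Sfin} [D SD] : exists D, S = D%:E.
    by move: S0 Sfin; case: S => // D _ _; exists D.
  rewrite SD lee_fin in S0 *; apply/lee_addgt0Pr => e e0.
  apply: ereal_inf_lbound; exists (D + e) => //; split; first by rewrite addr_ge0 // ltW.
  apply: hausdorff_measure_C_GLS_eq0 gls _ _; first by rewrite addr_ge0 // ltW.
  rewrite ltNge; apply/negP => De.
  have : ((D + e)%:E <= S)%E by apply: ereal_sup_ubound; exists (D + e).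
  by rewrite SD lee_fin; lra.
(* If H^s vanishes with s < S, some admissible t exceeds s, and the positivity of H^s is
   contradicted. *)
apply: le_ereal_inf_tmp => _ [s [s0 Hs] <-]; rewrite leNgt; apply/negP.
move=> /ereal_sup_gt [_ [t /= Vt <-]]; rewrite lte_fin => st.
have := hausdorff_measure_C_GLS_gt0 _ _ _ _ s t gls _ Vt.
by rewrite s0 st Hs ltxx => /(_ isT).
Qed.
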